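(* Let $L/F_0$ be a cyclic Galois field extension of degree $n$ with $\mathrm{Gal}(L/F_0)=\langle\sigma\rangle$ and $F/F_0$ a cyclic Galois field extension of degree $m$ with $\mathrm{Gal}(F/F_0)=\langle\tau\rangle$. Assume $L$ and $F$ are linearly disjoint over $F_0$ and let $K=L\otimes_{F_0}F=L\cdot F$ be their composite, with $\sigma$ and $\tau$ canonically extended to $K$. Let $c\in F_0^\times$ and $d\in F^\times$. (i) As $F_0$-algebras, $$(L/F_0,\sigma,c)\otimes_{F_0}(F/F_0,\tau,d)\cong \mathrm{It}_R^m\big((L/F_0,\sigma,c)\otimes_{F_0}F,\tau,d\big).$$ (ii) Suppose that $D=(L/F_0,\sigma,c)\otimes_{F_0}F$ is a division algebra. Then $$S_f\cong (L/F_0,\sigma,c)\otimes_{F_0}(F/F_0,\tau,d),$$ where $R=D[t;\widetilde\tau^{-1}]$ and $f(t)=t^m-d\in R$.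
   Context: Algebras are unital but not necessarily associative. A nonzero algebra $A$ is a division algebra if for every $a\ne0$ in $A$ the left and right multiplications by $a$ are bijective. Cyclic algebras: for a cyclic Galois extension $E/k$ of degree $r$ with $\mathrm{Gal}(E/k)=\langle\rho\rangle$ and $a\in E^\times$, $(E/k,\rho,a)=E\oplus eE\oplus\dots\oplus e^{r-1}E$ is the $k$-algebra with biadditive multiplication, for $x,y\in E$, $0\le i,j<r$, $(e^ix)(e^jy)=e^{i+j}\rho^j(x)y$ if $i+j<r$, and $(e^ix)(e^jy)=e^{(i+j)-r}a\rho^j(x)y$ if $i+j\ge r$. It is associative if $a\in k^\times$ (an associative cyclic algebra), and is called a nonassociative cyclic algebra if $a\in E\setminus k$. Extensions: on $K$, $\sigma$ is the identity on $F$ and $\tau$ is the identity on $L$, so $\mathrm{Gal}(K/F)=\langle\sigma\rangle$, $\mathrm{Gal}(K/L)=\langle\tau\rangle$, and $(L/F_0,\sigma,c)\otimes_{F_0}F=(K/F,\sigma,c)$. The map $\widetilde\tau$: on $D=(K/F,\sigma,c)$, $\widetilde\tau(\sum_i e^ix_i)=\sum_i e^i\tau(x_i)$ ($x_i\in K$); it is a ring automorphism since $c\in F_0$. Iterated algebra $\mathrm{It}_R^m(D,\tau,d)$: the free right $D$-module $D\oplus uD\oplus\dots\oplus u^{m-1}D$ with biadditive multiplication $(u^ix)(u^jy)=u^{i+j}\widetilde\tau^{j}(x)y$ if $i+j<m$, and $(u^ix)(u^jy)=u^{(i+j)-m}\widetilde\tau^{j}(x)yd$ if $i+j\ge m$,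 for $x,y\in D$, $0\le i,j<m$. It is an algebra over $F_0$; $D$ need not be a division algebra in this definition. (The subscript $R$ in $\mathrm{It}_R^m$ is only part of the notation.) Twisted polynomial ring: $D[t;\rho]$ ($\rho$ a ring automorphism of $D$) is the ring of polynomials $\sum a_it^i$, $a_i\in D$, with $ta=\rho(a)t$. The algebra $S_f$: for $f\in D[t;\rho]$ of degree $m$, $D$ a division ring, $S_f$ is the set $\{g\in D[t;\rho]\mid\deg g<m\}$ with usual addition and multiplication $g\circ h=gh\ \mathrm{mod}_r f$, the unique remainder $r$ with $\deg r<m$ in $gh=qf+r$. *)

(* Defs.v *)
From HB Require Import structures.
From mathcomp Require Import all_boot all_order all_algebra all_fingroup.
From mathcomp Require Import all_field.
From mathcomp Require Import zify.
From mathcomp Require Import boolp classical_sets functions.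
Set Implicit Arguments. Unset Strict Implicit. Unset Printing Implicit Defensive.
Import GRing.Theory.
Local Open Scope ring_scope.

(* Algebras need not be associative, so an algebra over k is a k-module V with
   a multiplication V -> V -> V satisfying [unital_algebra]. *)
Section Algebras.
Variable k : fieldType.

Definition unital_algebra (V : lmodType k) (mul : V -> V -> V) :=
  [/\ forall y, linear (mul^~ y), forall x, linear (mul x)
    & exists one : V, left_id one mul /\ right_id one mul].

Definition division_algebra (V : lmodType k) (mul : V -> V -> V) :=
  (exists a : V, a != 0) /\
  forall a : V, a != 0 -> bijective (mul a) /\ bijective (mul^~ a).

Definition algebra_iso (V W : lmodType k)
    (mulV : V -> V -> V) (mulW : W -> W -> W) :=
  exists2 phi : {linear V -> W},
    bijective phi & {morph phi : x y / mulV x y >-> mulW x y}.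

End Algebras.

(* A (x) B in coordinates with respect to the standard bases of A and B. *)
Section Tensor.
Variables (k : fieldType) (A B : vectType k).

Definition tens := 'M[k]_(\dim {:A}, \dim {:B}).

Definition pure (a : A) (b : B) : tens :=
  \matrix_(i, j) (coord (vbasis {:A}) i a * coord (vbasis {:B}) j b).

Definition tens_mul (mulA : A -> A -> A) (mulB : B -> B -> B) (X Y : tens)
    : tens :=
  \sum_i \sum_j \sum_i' \sum_j' (X i j * Y i' j') *:
    pure (mulA (vbasis {:A})`_i (vbasis {:A})`_i')
         (mulB (vbasis {:B})`_j (vbasis {:B})`_j').

End Tensor.

(* g^i x in x_0 + g x_1 + ... + g^(r-1) x_(r-1) *)
Definition gmon (V : nmodType) (r i : nat) (x : V) : {ffun 'I_r -> V} :=
  [ffun l : 'I_r => if l == i :> nat then x else 0].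
Arguments gmon {V} r i x.

(* (E/k, rho, a), r = [E : k]: the function x stands for \sum_i e^i (x i). *)
Section Cyclic.
Variables (E : fieldType) (r : nat) (rho : E -> E) (a : E).
Implicit Types x y : {ffun 'I_r -> E}.

Definition cyc_mul x y : {ffun 'I_r -> E} :=
  [ffun l : 'I_r => \sum_(i < r) \sum_(j < r)
    if (i + j == l)%N then iter j rho (x i) * y j
    else if (i + j == l + r)%N then a * iter j rho (x i) * y j
    else 0].

Definition coefwise (t : E -> E) x : {ffun 'I_r -> E} := [ffun i => t (x i)].

End Cyclic.

(* It_R^m(D, rho, d): the function x stands for \sum_i u^i (x i). *)
Definition it_mul (D : zmodType) (mulD : D -> D -> D) (m : nat)
    (rho : D -> D) (d : D) (x y : {ffun 'I_m -> D}) : {ffun 'I_m -> D} :=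
  [ffun l : 'I_m => \sum_(i < m) \sum_(j < m)
    if (i + j == l)%N then mulD (iter j rho (x i)) (y j)
    else if (i + j == l + m)%N then mulD (mulD (iter j rho (x i)) (y j)) d
    else 0].

Fact gmon_sum (V W : nmodType) (r i j : nat) (h : nat -> nat -> V -> V -> W)
    (x y : V) :
    (i < r)%N -> (j < r)%N ->
    (forall i j z, h i j 0 z = 0) -> (forall i j z, h i j z 0 = 0) ->
  \sum_(i' < r) \sum_(j' < r) h i' j' (gmon r i x i') (gmon r j y j') = h i j x y.
Proof.
move=> hi hj h0l h0r; rewrite (bigD1 (Ordinal hi)) //= [X in _ + X]big1 ?addr0.
  rewrite (bigD1 (Ordinal hj)) //= [X in _ + X]big1 ?addr0 => [|j' nj].
    by rewrite !ffunE /= !eqxx.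
  rewrite [gmon r j y j']ffunE ifN ?h0r //.
move=> i' ni; apply: big1 => j' _; rewrite ffunE ifN ?h0l //.
Qed.

Lemma cyc_mul_gmon (E : fieldType) (r : nat) (rho : {additive E -> E}) (a : E)
    (i j : nat) (x y : E) : (i < r)%N -> (j < r)%N ->
  cyc_mul rho a (gmon r i x) (gmon r j y) =
    if (i + j < r)%N then gmon r (i + j) (iter j rho x * y)
    else gmon r (i + j - r) (a * iter j rho x * y).
Proof.
move=> hi hj; apply/ffunP => l; rewrite ffunE.
have iter0 s : iter s rho 0 = 0 by elim: s => //= s ->; exact: raddf0.
pose h (i j : nat) (x y : E) := if (i + j == l)%N then iter j rho x * y
    else if (i + j == l + r)%N then a * iter j rho x * y else 0.
rewrite (gmon_sum (h := h)) //; first last.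
- by move=> ? ? ?; rewrite /h !mulr0 !if_same.
- by move=> ? ? ?; rewrite /h iter0 !(mulr0, mul0r) !if_same.
rewrite /h; have [lt|ge] := ltnP; rewrite ffunE eq_sym //.
  have [//|_] := eqP; rewrite ifN //; apply/eqP; have := ltn_ord l; lia.
rewrite ifN; last by apply/eqP; have := ltn_ord l; lia.
by congr (if _ then _ else _); apply/eqP/eqP; lia.
Qed.

Lemma it_mul_gmon (D : zmodType) (mulD : D -> D -> D) (m : nat)
    (rho : {additive D -> D}) (d : D) (i j : nat) (x y : D) :
    (forall z, mulD 0 z = 0) -> (forall z, mulD z 0 = 0) ->
    (i < m)%N -> (j < m)%N ->
  it_mul mulD rho d (gmon m i x) (gmon m j y) =
    if (i + j < m)%N then gmon m (i + j) (mulD (iter j rho x) y)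
    else gmon m (i + j - m) (mulD (mulD (iter j rho x) y) d).
Proof.
move=> h0l h0r hi hj; apply/ffunP => l; rewrite ffunE.
have iter0 s : iter s rho 0 = 0 by elim: s => //= s ->; exact: raddf0.
pose h (i j : nat) (x y : D) := if (i + j == l)%N then mulD (iter j rho x) y
    else if (i + j == l + m)%N then mulD (mulD (iter j rho x) y) d else 0.
rewrite (gmon_sum (h := h)) //; first last.
- by move=> ? ? ?; rewrite /h !(h0l, h0r) !if_same.
- by move=> ? ? ?; rewrite /h iter0 !(h0l, h0r) !if_same.
rewrite /h; have [lt|ge] := ltnP; rewrite ffunE eq_sym //.
  have [//|_] := eqP; rewrite ifN //; apply/eqP; have := ltn_ord l; lia.
rewrite ifN; last by apply/eqP; have := ltn_ord l; lia.
by congr (if _ then _ else _); apply/eqP/eqP; lia.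
Qed.

(* Polynomials in t with left coefficients in D, as finitely supported
   coefficient functions. *)
Section Skew.
Variables (k : fieldType) (D : lmodType k).

Definition fin_supp : {pred nat -> D} :=
  fun p => `[< exists N, forall i, (N <= i)%N -> p i = 0 >].

Fact fin_supp_submod : submod_closed fin_supp.
Proof.
split; first by apply/asboolP; exists 0%N.
move=> c p q /asboolP [N hN] /asboolP [M hM]; apply/asboolP.
exists (maxn N M) => i; rewrite geq_max => /andP [hi hj].
by rewrite [LHS](_ : _ = c *: p i + q i) // hN // hM // scaler0 addr0.
Qed.
HB.instance Definition _ := GRing.isSubmodClosed.Build k (nat -> D) fin_supp
  fin_supp_submod.

Record skewpoly := Skewpoly { scoef :> nat -> D; _ : scoef \in fin_supp }.
HB.instance Definition _ := [isSub for scoef].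
HB.instance Definition _ := [Choice of skewpoly by <:].
HB.instance Definition _ := [SubChoice_isSubLmodule of skewpoly by <:].

Definition deg_lt (m : nat) : {pred skewpoly} :=
  fun p => `[< forall i, (m <= i)%N -> p i = 0 >].

Fact deg_lt_submod m : submod_closed (deg_lt m).
Proof.
split; first by apply/asboolP.
move=> c p q /asboolP hp /asboolP hq; apply/asboolP => i hi.
by rewrite [LHS](_ : _ = c *: p i + q i) // hp // hq // scaler0 addr0.
Qed.

HB.instance Definition _ m := GRing.isSubmodClosed.Build k skewpoly (deg_lt m)
  (deg_lt_submod m).

Record skewpoly_lt m := SkewpolyLt { sval_lt :> skewpoly; _ : sval_lt \in deg_lt m }.
HB.instance Definition _ m := [isSub for @sval_lt m].
HB.instance Definition _ m := [Choice of skewpoly_lt m by <:].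
HB.instance Definition _ m := [SubChoice_isSubLmodule of skewpoly_lt m by <:].

Fact smon_subproof (a : D) (n : nat) :
  (fun i => if i == n then a else 0) \in fin_supp.
Proof.
apply/asboolP; exists n.+1 => i hi; case: eqP => // ein.
by rewrite ein ltnn in hi.
Qed.

(* a t^n *)
Definition smon (a : D) (n : nat) : skewpoly := Skewpoly (smon_subproof a n).

Variables (mulD : D -> D -> D) (rho : D -> D).

(* The product of D[t; rho], from (a t^i)(b t^j) = a rho^i(b) t^(i+j).  The
   convolution is finitely supported as soon as mulD is biadditive and rho
   additive (see [skew_mulE]). *)
Definition skew_mul (p q : skewpoly) : skewpoly :=
  insubd 0 (fun l : nat => \sum_(i < l.+1) mulD (p i) (iter i rho (q (l - i)%N))).

(* Multiplication of S_f, for f of degree m: the remainder r of the product in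
   gh = qf + r with deg r < m (unique by [skew_div]). *)
Definition Sf_mul (m : nat) (f : skewpoly) (g h : skewpoly_lt m) : skewpoly_lt m :=
  xget 0 [set r : skewpoly_lt m |
    exists q, skew_mul g h = skew_mul q f + sval_lt r]%classic.

End Skew.

Section LinearlyDisjoint.
Variables (k : fieldType) (L F K : fieldExtType k).
Variables (iL : 'AHom(L, K)) (iF : 'AHom(F, K)).

Definition linearly_disjoint :=
  forall X : seq L, free X -> forall y : 'I_(size X) -> F,
    \sum_(i < size X) iL X`_i * iF (y i) = 0 -> forall i, y i = 0.

End LinearlyDisjoint.

Lemma cyc_mul_it (E : fieldType) (r : nat) (rho : E -> E) (a : E) :
  @cyc_mul E r rho a = it_mul *%R rho a.
Proof.
apply/funext => x; apply/funext => y; apply/ffunP => l; rewrite !ffunE.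
apply: eq_bigr => i _; apply: eq_bigr => j _.
by rewrite -mulrA [a * _]mulrC.
Qed.

Lemma unital_algebra_it (k : fieldType) (D : lmodType k) (mulD : D -> D -> D)
    (m : nat) (rho : {linear D -> D}) (d : D) :
    unital_algebra mulD -> (forall one, left_id one mulD -> rho one = one) ->
  unital_algebra (@it_mul D mulD m rho d).
Proof.
move=> [linl linr [one [one1l one1r]]] /(_ one one1l) rho1.
have iterP j : linear (iter j rho).
  by elim: j => // j IH c x y; rewrite !iterS IH linearP.
have mul0l z : mulD 0 z = 0.
  by have := linl z (- 1) 0 0; rewrite scaler0 addr0 scaleN1r addNr.
have iter1 j : iter j rho one = one by elim: j => //= j ->.
split.
- move=> y c x x'; apply/ffunP => l; rewrite !ffunE scaler_sumr -big_split.
  apply: eq_bigr => i _; rewrite scaler_sumr -big_split; apply: eq_bigr => j _.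
  by rewrite !ffunE iterP !linl; do 2!case: ifP => //= _; rewrite scaler0 addr0.
- move=> x c y y'; apply/ffunP => l; rewrite !ffunE scaler_sumr -big_split.
  apply: eq_bigr => i _; rewrite scaler_sumr -big_split; apply: eq_bigr => j _.
  by rewrite !ffunE !linr !linl; do 2!case: ifP => //= _; rewrite scaler0 addr0.
exists (gmon m 0 one); split=> x; apply/ffunP => l; rewrite ffunE.
  have m0 : (0 < m)%N := leq_ltn_trans (leq0n l) (ltn_ord l).
  rewrite (bigD1 (Ordinal m0)) //= [X in _ + X]big1 ?addr0 => [|i ni].
    rewrite (bigD1 l) //= [X in _ + X]big1 ?addr0 => [|j nj].
      by rewrite add0n eqxx ffunE /= iter1 one1l.
    rewrite add0n ifN ?ifN //; have := ltn_ord j; lia.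
  have g0 : gmon m 0 one i = 0 by rewrite ffunE ifN.
  apply: big1 => j _; rewrite g0.
  have -> : iter j rho 0 = 0.
    by elim: (nat_of_ord j) => //= s ->; rewrite raddf0.
  by rewrite !mul0l !if_same.
have m0 : (0 < m)%N := leq_ltn_trans (leq0n l) (ltn_ord l).
have mul0r z : mulD z 0 = 0.
  by have := linr z (- 1) 0 0; rewrite scaler0 addr0 scaleN1r addNr.
rewrite exchange_big (bigD1 (Ordinal m0)) //= [X in _ + X]big1 ?addr0 => [|j nj].
  rewrite (bigD1 l) //= [X in _ + X]big1 ?addr0 => [|i ni].
    by rewrite addn0 eqxx ffunE /= one1r.
  rewrite addn0 ifN ?ifN //; have := ltn_ord i; lia.
have g0 : gmon m 0 one j = 0 by rewrite ffunE ifN.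
apply: big1 => i _; rewrite g0.
by rewrite !(mul0r, mul0l) !if_same.
Qed.

Lemma unital_algebra_cyc (k : fieldType) (E : fieldExtType k) (r : nat)
    (rho : 'AEnd(E)) (a : E) : unital_algebra (@cyc_mul E r rho a).
Proof.
rewrite cyc_mul_it; apply: unital_algebra_it.
  split; first by move=> y c x x'; rewrite mulrDl scalerAl.
    by move=> x c y y'; rewrite mulrDr scalerAr.
  by exists 1; split => x; rewrite ?mul1r ?mulr1.
by move=> one one1; rewrite -[one]mulr1 one1 rmorph1.
Qed.

Definition linear_pack (k : fieldType) (V W : lmodType k) (f : V -> W)
    (fP : linear f) : {linear V -> W} :=
  HB.pack f (GRing.isLinear.Build k V W *:%R f fP).

Section TensorTheory.
Variables (k : fieldType) (A B : vectType k).

Lemma pure_bilinear : (forall b : B, linear (fun a : A => pure a b : tens A B)) /\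
  (forall a : A, linear (fun b : B => pure a b : tens A B)).
Proof.
split=> [b c x y|a c x y]; apply/matrixP => i j; rewrite !mxE linearP.
  by rewrite mulrDl -mulrA.
by rewrite mulrDr mulrCA.
Qed.


Local Notation bA := (vbasis {:A}).
Local Notation bB := (vbasis {:B}).

Lemma pure_basis (i : 'I_(\dim {:A})) (j : 'I_(\dim {:B})) : pure bA`_i bB`_j = delta_mx i j :> tens A B.
Proof.
have fA := basis_free (vbasisP {:A}); have fB := basis_free (vbasisP {:B}).
apply/matrixP => p q; rewrite !mxE !coord_free //.
by rewrite -natrM mulnb [i == p]eq_sym [j == q]eq_sym.
Qed.

Lemma tens_ext (V : lmodType k) (f g : {linear tens A B -> V}) :
  (forall a b, f (pure a b) = g (pure a b)) -> f =1 g.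
Proof.
move=> fg X; rewrite (matrix_sum_delta X) !linear_sum; apply: eq_bigr => i _.
rewrite !linear_sum; apply: eq_bigr => j _.
by rewrite !linearZ /= -pure_basis fg.
Qed.

Lemma bilinear_pure (V : lmodType k) (phi : A -> B -> V) a b :
    (forall b, linear (phi^~ b)) -> (forall a, linear (phi a)) ->
  phi a b = \sum_i \sum_j pure a b i j *: phi bA`_i bB`_j.
Proof.
move=> phil phir.
pose phia a' := linear_pack (phir a').
pose phib b' := linear_pack (phil b').
rewrite [in LHS](coord_vbasis (memvf a)) [LHS](linear_sum (phib b)).
apply: eq_bigr => i _; rewrite [LHS](linearZ_LR (phib b)) /=.
rewrite [in LHS](coord_vbasis (memvf b)) [phi _ _](linear_sum (phia _)).
rewrite scaler_sumr; apply: eq_bigr => j _.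
by rewrite [X in _ *: X](linearZ_LR (phia _)) mxE scalerA.
Qed.

Lemma tens_universal (V : lmodType k) (phi : A -> B -> V) :
    (forall b, linear (phi^~ b)) -> (forall a, linear (phi a)) ->
  exists f : {linear tens A B -> V}, forall a b, f (pure a b) = phi a b.
Proof.
move=> phil phir.
pose f (X : tens A B) := \sum_i \sum_j X i j *: phi bA`_i bB`_j.
have fP : linear f.
  move=> c X Y; rewrite scaler_sumr -big_split; apply: eq_bigr => i _.
  rewrite scaler_sumr -big_split; apply: eq_bigr => j _.
  by rewrite !mxE scalerDl scalerA.
by exists (linear_pack fP) => a b; rewrite [RHS]bilinear_pure.
Qed.

Variables (mulA : A -> A -> A) (mulB : B -> B -> B).
Hypotheses (algA : unital_algebra mulA) (algB : unital_algebra mulB).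

Lemma tens_mul_linear : (forall Y, linear ((@tens_mul _ A B mulA mulB)^~ Y)) /\
  (forall X, linear (@tens_mul _ A B mulA mulB X)).
Proof.
split=> [Y c X X'|X c Y Y']; rewrite /tens_mul.
all: do 4![rewrite scaler_sumr -big_split; apply: eq_bigr => ? _].
  by rewrite /= !mxE scalerA -scalerDl mulrDl mulrA.
by rewrite /= !mxE scalerA -scalerDl mulrDr mulrCA.
Qed.

Lemma tens_mul_pure a b a' b' :
  tens_mul mulA mulB (pure a b) (pure a' b') = pure (mulA a a') (mulB b b').
Proof.
have [lA rA _] := algA; have [lB rB _] := algB.
have [pl pr] := pure_bilinear.
have pureM a1 b1 a2 b2 : (forall b, linear (fun a => pure (mulA a a2) b : tens A B))
    /\ (forall a, linear (fun b => pure a (mulB b b2) : tens A B))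
    /\ (forall b, linear (fun a => pure (mulA a1 a) b : tens A B))
    /\ (forall a, linear (fun b => pure a (mulB b1 b) : tens A B)).
  by split; [|split; [|split]] => ? ? ? ?; rewrite ?(lA, lB, rA, rB) ?(pl, pr).
have [pl1 [pr1 _]] := pureM 0 0 a' b'.
rewrite [RHS](bilinear_pure (phi := fun a b => pure (mulA a a') (mulB b b'))) //.
apply: eq_bigr => i _; apply: eq_bigr => j _.
have [_ [_ [pl2 pr2]]] := pureM bA`_i bB`_j 0 0.
rewrite [in RHS](bilinear_pure (phi := fun a b => pure (mulA _ a) (mulB _ b))) //.
rewrite scaler_sumr; apply: eq_bigr => i' _.
by rewrite scaler_sumr; apply: eq_bigr => j' _; rewrite scalerA.
Qed.

Lemma unital_algebra_tens : unital_algebra (@tens_mul _ A B mulA mulB).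
Proof.
have [tl tr] := tens_mul_linear.
have [_ _ [u [ul ur]]] := algA; have [_ _ [v [vl vr]]] := algB.
split; [exact: tl | exact: tr | exists (pure u v); split].
  pose g := linear_pack (tr (pure u v)).
  apply: (tens_ext (f := g) (g := idfun)) => a b /=.
  by rewrite tens_mul_pure ul vl.
pose g := linear_pack (tl (pure u v)).
apply: (tens_ext (f := g) (g := idfun)) => a b /=.
by rewrite tens_mul_pure ur vr.
Qed.

End TensorTheory.

Lemma coefwiseM (E : fieldType) (r : nat) (rho : E -> E) (a : E)
    (t : {rmorphism E -> E}) :
    (forall x, t (rho x) = rho (t x)) -> t a = a ->
  {morph @coefwise E r t : x y / cyc_mul rho a x y}.
Proof.
move=> trho ta x y; apply/ffunP => l; rewrite !ffunE rmorph_sum.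
have titer j z : t (iter j rho z) = iter j rho (t z).
  by elim: j => //= j <-.
apply: eq_bigr => i _; rewrite rmorph_sum; apply: eq_bigr => j _.
by rewrite !ffunE; case: ifP => _; last (case: ifP => _); rewrite ?rmorph0 ?rmorphM ?titer ?ta.
Qed.

Lemma coefwise_inv (k : fieldType) (E : fieldExtType k) (r : nat) (t : 'AEnd(E)) :
  cancel (@coefwise E r t) (coefwise (inv_ahom t)) /\
  cancel (@coefwise E r (inv_ahom t)) (coefwise t).
Proof.
have t0 := AEnd_lker0 t.
split=> x; apply/ffunP => i; rewrite !ffunE /=.
  by rewrite lker0_lfunK.
by rewrite lker0_lfunVK.
Qed.

(* (L/k, sigma, c) (x) F = (K/F, sigma, c) *)
Lemma cyc_tens_iso (k : fieldType) (L F K : fieldExtType k) (n : nat)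
    (iL : 'AHom(L, K)) (iF : 'AHom(F, K)) (sigma : 'AEnd(L)) (sigmaK : 'AEnd(K))
    (c : k) :
    linearly_disjoint iL iF -> ({:K} = limg iL * limg iF)%VS ->
    (forall x, sigmaK (iL x) = iL (sigma x)) ->
    (forall y, sigmaK (iF y) = iF y) ->
  exists phi : {linear tens {ffun 'I_n -> L} F -> {ffun 'I_n -> K}},
  [/\ bijective phi,
      forall a b, phi (pure a b) = [ffun i => iL (a i) * iF b]
    & {morph phi : x y / tens_mul (cyc_mul sigma c%:A) *%R x y
                     >-> cyc_mul sigmaK c%:A x y}].
Proof.
move=> LF_disj K_comp sL sF.
pose psi (a : {ffun 'I_n -> L}) (b : F) : {ffun 'I_n -> K} :=
  [ffun i => iL (a i) * iF b].
have psil b : linear (psi^~ b).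
  by move=> z x y; apply/ffunP => i; rewrite !ffunE linearP mulrDl scalerAl.
have psir a : linear (psi a).
  by move=> z x y; apply/ffunP => i; rewrite !ffunE linearP mulrDr scalerAr.
have [phi phiE] := tens_universal psil psir.
exists phi; split=> //; last first.
  have algL := @unital_algebra_cyc k L n sigma c%:A.
  have algF : @unital_algebra k F *%R.
    split; first by move=> y z x x'; rewrite mulrDl scalerAl.
      by move=> x z y y'; rewrite mulrDr scalerAr.
    by exists 1; split => x; rewrite ?mul1r ?mulr1.
  have [algKl algKr _] := @unital_algebra_cyc k K n sigmaK c%:A.
  have [tl tr] := @tens_mul_linear k {ffun 'I_n -> L} F (cyc_mul sigma c%:A) *%R.
  have iLc : iL c%:A = c%:A by rewrite linearZ /= rmorph1.
  move=> X Y.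
  pose g1 Y := linear_pack (tl Y); pose h1 y := linear_pack (algKl y).
  pose g2 X := linear_pack (tr X); pose h2 x := linear_pack (algKr x).
  apply: (tens_ext (f := phi \o g1 Y) (g := h1 (phi Y) \o phi)) => a b /=.
  apply: (tens_ext (f := phi \o g2 _) (g := h2 _ \o phi)) => a' b' /=.
  rewrite tens_mul_pure // !phiE; apply/ffunP => l; rewrite !ffunE.
  rewrite rmorph_sum mulr_suml; apply: eq_bigr => i _.
  rewrite rmorph_sum mulr_suml; apply: eq_bigr => j _; rewrite !ffunE.
  have -> : iter j sigmaK (iL (a i) * iF b) = iL (iter j sigma (a i)) * iF b.
    by elim: (nat_of_ord j) => //= s ->; rewrite rmorphM /= sL sF.
  rewrite !rmorphM; case: ifP => _; last (case: ifP => _); rewrite ?rmorph0 ?mul0r //.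
    by rewrite !rmorphM mulrACA.
  by rewrite !rmorphM /= iLc -!mulrA; congr (_ * (_ * _)); rewrite mulrCA.
pose f := linfun phi.
have fE X : f X = phi X by rewrite lfunE.
have f0 : lker f == 0%VS.
  apply/eqP/vspaceP => X; rewrite memv_ker memv0 fE; apply/eqP/eqP => [X0|->]; last first.
    by rewrite linear0.
  have phiX : phi X = \sum_p \sum_q
      X p q *: psi (vbasis {:{ffun 'I_n -> L}})`_p (vbasis {:F})`_q.
    rewrite [in LHS](matrix_sum_delta X) linear_sum; apply: eq_bigr => p _.
    rewrite linear_sum; apply: eq_bigr => q _.
    by rewrite linearZ /= -pure_basis phiE.
  have freeA := basis_free (vbasisP {:{ffun 'I_n -> L}}).
  have freeL := basis_free (vbasisP {:L}); have freeF := basis_free (vbasisP {:F}).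
  suff z0 (q : 'I_(\dim {:F})) (i : 'I_n) :
      \sum_p X p q *: (vbasis {:{ffun 'I_n -> L}})`_p i = 0.
    apply/matrixP => p0 q0; rewrite mxE.
    suff S : \sum_p X p q0 *: (vbasis {:{ffun 'I_n -> L}})`_p = 0.
      exact: (elimT freeP freeA (fun p => X p q0) S p0).
    apply/ffunP => i.
    rewrite sum_ffunE ffunE -[RHS](z0 q0 i); apply: eq_bigr => p _.
    by rewrite !ffunE.
  pose z q : L := \sum_p X p q *: (vbasis {:{ffun 'I_n -> L}})`_p i.
  pose y s : F := \sum_q coord (vbasis {:L}) s (z q) *: (vbasis {:F})`_q.
  have y0 s : y s = 0.
    have eqL := size_tuple (vbasis {:L}).
    rewrite -[s](cast_ordKV eqL).
    apply: (LF_disj _ freeL (fun s => y (cast_ord eqL s))).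
    rewrite (reindex (cast_ord (esym eqL))) /=; last first.
      exists (cast_ord eqL) => s' _; [exact: cast_ordKV | exact: cast_ordK].
    under eq_bigr => s' _ do rewrite cast_ordKV linear_sum mulr_sumr.
    rewrite exchange_big /=; transitivity (phi X i); last by rewrite X0 ffunE.
    rewrite phiX [in RHS]exchange_big sum_ffunE /=.
    apply: eq_bigr => q1 _.
    rewrite sum_ffunE.
    transitivity (iL (z q1) * iF (vbasis {:F})`_q1).
      rewrite [in RHS](coord_vbasis (memvf (z q1))) linear_sum mulr_suml.
      by apply: eq_bigr => s' _; rewrite !linearZ /= -scalerAr -scalerAl.
    rewrite linear_sum mulr_suml; apply: eq_bigr => p _.
    by rewrite !ffunE linearZ /= scalerAl.
  rewrite -/(z q) [z q](coord_vbasis (memvf (z q))) big1 // => s _.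
  by rewrite (elimT freeP freeF (fun q => coord (vbasis {:L}) s (z q)) (y0 s) q) scale0r.
have dimiL : \dim (limg iL) = \dim {:L}.
  by apply: limg_dim_eq; apply/eqP; rewrite capfv; apply/eqP; exact/eqP/AHom_lker0.
have dimiF : \dim (limg iF) = \dim {:F}.
  by apply: limg_dim_eq; apply/eqP; rewrite capfv; apply/eqP; exact/eqP/AHom_lker0.
have f1 : limg f = fullv.
  apply/eqP; rewrite eqEdim subvf limg_dim_eq; last by rewrite (eqP f0) capv0.
  have dimff (V : vectType k) : \dim {:{ffun 'I_n -> V}} = (n * \dim {:V})%N.
    by rewrite !dimvf {1}/dim /= card_ord.
  have dimM p q : \dim {:'M[k]_(p, q)} = (p * q)%N by rewrite dimvf /dim /=.
  rewrite dimM !dimff -mulnA leq_mul2l; apply/orP; right.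
  by rewrite -dimiL -dimiF K_comp dim_prodv.
exists (f^-1)%VF => X.
  by rewrite -fE lker0_lfunK.
by rewrite -fE limg_lfunVK // f1 memvf.
Qed.

Section SkewTheory.
Variables (k : fieldType) (D : lmodType k) (mulD : D -> D -> D).
Variable rho : {linear D -> D}.
Hypothesis algD : unital_algebra mulD.

Let mul0D z : mulD 0 z = 0.
Proof.
by have [lin _ _] := algD; have := lin z (- 1) 0 0; rewrite scaler0 addr0 scaleN1r addNr.
Qed.
Let mulD0 z : mulD z 0 = 0.
Proof.
by have [_ lin _] := algD; have := lin z (- 1) 0 0; rewrite scaler0 addr0 scaleN1r addNr.
Qed.
Let mulDDl x y z : mulD (x + y) z = mulD x z + mulD y z.
Proof. by have [lin _ _] := algD; have := lin z 1 x y; rewrite !scale1r. Qed.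
Let iter0 i : iter i rho 0 = 0.
Proof. by elim: i => //= i ->; rewrite raddf0. Qed.

Lemma skew_mulE p q (l : nat) :
  skew_mul mulD rho p q l = \sum_(i < l.+1) mulD (p i) (iter i rho (q (l - i)%N)).
Proof.
pose conv (l : nat) := \sum_(i < l.+1) mulD (p i) (iter i rho (q (l - i)%N)).
suff cP : conv \in @fin_supp k D.
  exact: (congr1 (fun h : nat -> D => h l) (insubdK (0 : skewpoly D) cP)).
apply/asboolP.
have /asboolP [N hN] := valP p; have /asboolP [M hM] := valP q.
exists (N + M)%N => i hi; apply: big1 => j _.
have [Nj|jN] := leqP N j; first by rewrite hN.
by rewrite hM ?iter0 //; lia.
Qed.

Lemma scoef_fin (p : skewpoly D) : exists N, forall i, (N <= i)%N -> p i = 0.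
Proof. exact/asboolP/(valP p). Qed.

Lemma skewP (p q : skewpoly D) : (forall i, p i = q i) -> p = q.
Proof. by move=> pq; apply/val_inj/funext. Qed.

Lemma scoefD (p q : skewpoly D) i : (p + q) i = p i + q i. Proof. by []. Qed.
Lemma scoefN (p : skewpoly D) i : (- p) i = - p i. Proof. by []. Qed.

(* t a = rho(a) t *)
Lemma skew_mulXC (one a : D) : left_id one mulD -> right_id one mulD -> rho one = one ->
  skew_mul mulD rho (smon one 1) (smon a 0) = skew_mul mulD rho (smon (rho a) 0) (smon one 1).
Proof.
move=> one_l one_r rho1; apply: skewP => l; rewrite !skew_mulE.
case: l => [|l].
  by rewrite !big_ord1 /= !(mul0D, mulD0).
rewrite !big_ord_recl /= !mul0D !add0r big1 ?addr0 => [|i _]; last by rewrite mul0D.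
rewrite big1 ?addr0 => [|i _]; last by rewrite mul0D.
rewrite one_l /bump /= subSS subn0 eqSS.
by case: eqP => _; rewrite ?rho1 ?one_r ?raddf0 ?mulD0.
Qed.

Lemma skew_mulDl p q f :
  skew_mul mulD rho (p + q) f = skew_mul mulD rho p f + skew_mul mulD rho q f.
Proof.
apply: skewP => l; rewrite scoefD !skew_mulE -big_split.
by apply: eq_bigr => i _; rewrite scoefD mulDDl.
Qed.

Lemma skew_mul0l f : skew_mul mulD rho 0 f = 0.
Proof. by apply: skewP => l; rewrite skew_mulE big1. Qed.

Lemma skew_div (m : nat) (f g : skewpoly D) :
    division_algebra mulD -> injective rho ->
    f m != 0 -> (forall i, (m < i)%N -> f i = 0) ->
  exists! r : skewpoly_lt D m, exists q, g = skew_mul mulD rho q f + sval_lt r.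
Proof.
move=> [_ divD] rho_inj fm fdeg.
have fm_neq0 i : iter i rho (f m) != 0.
  by elim: i => //= i IH; rewrite -(raddf0 rho) (inj_eq rho_inj).
have lt0 (r : skewpoly_lt D m) i : (m <= i)%N -> sval_lt r i = 0.
  by have /asboolP := valP r; apply.
have ex : exists r : skewpoly_lt D m, exists q, g = skew_mul mulD rho q f + sval_lt r.
  have [N hN] := scoef_fin g.
  elim: N g hN => [|N IH] g hN.
    exists 0, 0; rewrite skew_mul0l; apply: skewP => i; rewrite addr0.
    exact: hN.
  have [ltNm|leNm] := ltnP N m.
    have gm : g \in deg_lt m.
      by apply/asboolP => i hi; apply: hN; apply: leq_trans hi.
    by exists (SkewpolyLt gm), 0; rewrite skew_mul0l add0r.
  have [b bE] : exists b, mulD b (iter (N - m) rho (f m)) = g N.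
    have [_ [h _ hK]] := divD _ (fm_neq0 (N - m)%N).
    by exists (h (g N)); rewrite hK.
  have smulE l : skew_mul mulD rho (smon b (N - m)) f l =
      if (N - m <= l)%N then mulD b (iter (N - m) rho (f (l - (N - m))%N)) else 0.
    rewrite skew_mulE; case: leqP => [le|lt].
      have lt : (N - m < l.+1)%N by [].
      rewrite (bigD1 (Ordinal lt)) //= eqxx big1 ?addr0 // => i ni.
      by rewrite ifN ?mul0D.
    apply: big1 => i _; rewrite /= ifN ?mul0D //.
    by have := ltn_ord i; lia.
  have [|r [q gE]] := IH (g - skew_mul mulD rho (smon b (N - m)) f).
    move=> i; rewrite leq_eqVlt => /orP [/eqP <-|ltNi].
      by rewrite scoefD scoefN smulE leq_subr subKn // bE subrr.
    rewrite scoefD scoefN hN // smulE fdeg ?iter0 ?mulD0 ?if_same ?subr0 //.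
    lia.
  exists r, (q + smon b (N - m)).
  by rewrite skew_mulDl addrAC -gE subrK.
have [r [q gE]] := ex; exists r; split; first by exists q.
move=> r' [q' gE'].
suff q0 i : (q - q') i = 0.
  have qq : q = q' by apply/eqP; rewrite -subr_eq0; apply/eqP/skewP.
  by apply/val_inj/(addrI (skew_mul mulD rho q f)); rewrite -gE gE' qq.
have mulq l : (m <= l)%N -> skew_mul mulD rho (q - q') f l = 0.
  move=> hl; have -> : skew_mul mulD rho (q - q') f = sval_lt r' - sval_lt r.
    apply: (addIr (skew_mul mulD rho q' f + sval_lt r)).
    rewrite addrA -skew_mulDl subrK -gE addrCA subrK -gE' //.
  by rewrite scoefD scoefN !lt0 // subr0.
have [N hN] := scoef_fin (q - q').
have [j ij] := ubnP (N - i)%N; elim: j i ij => // j IH i ij.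
have [/hN //|ltiN] := leqP N i.
have := mulq (i + m)%N (leq_addl _ _); rewrite skew_mulE.
have lt : (i < (i + m).+1)%N by lia.
rewrite (bigD1 (Ordinal lt)) //= addKn big1 ?addr0 => [h|i' ni].
  apply/eqP; apply: contraT => qi; have [[h1 h1K _] _] := divD _ qi.
  by case/eqP: (fm_neq0 i); apply: (can_inj h1K); rewrite h mulD0.
have [ltii|] := ltnP i i'.
  have e : (q - q') i' = 0 by apply: IH; lia.
  exact: etrans (congr1 (mulD^~ _) e) (mul0D _).
rewrite leq_eqVlt => /orP [/eqP e|lti'].
  by case/eqP: ni; apply/val_inj.
by rewrite fdeg ?iter0 ?mulD0 //; lia.
Qed.

Lemma Sf_mulP (m : nat) (f : skewpoly D) (g h : skewpoly_lt D m) :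
    division_algebra mulD -> injective rho ->
    f m != 0 -> (forall i, (m < i)%N -> f i = 0) ->
  exists q, skew_mul mulD rho g h =
    skew_mul mulD rho q f + sval_lt (Sf_mul mulD rho f g h).
Proof.
move=> divD rho_inj fm fdeg.
have [r [rP _]] := skew_div (skew_mul mulD rho g h) divD rho_inj fm fdeg.
by apply: (xgetPex 0 (P := [set r | exists q, _ = _ + sval_lt r]%classic)); exists r.
Qed.

End SkewTheory.

(* Main.v *)
Require Import Defs.
From mathcomp Require Import all_boot all_order all_algebra all_fingroup.
From mathcomp Require Import all_field.
From mathcomp Require Import zify.
From mathcomp Require Import boolp classical_sets functions.
Set Implicit Arguments. Unset Strict Implicit. Unset Printing Implicit Defensive.
Import GRing.Theory.
Local Open Scope ring_scope.

(** Both isomorphisms come from moving coefficients around.  A family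
    y : 'I_m -> B stands for \sum_j e^j y_j, so tensoring by A commutes with the
    formation of families: A (x) B^m = (A (x) B)^m ([tens_ffun_bij]).  If
    A (x) B = D as algebras and rho acts on B as rhoD = id (x) rho does on D,
    this bijection is multiplicative from A (x) It(B, rho, b) to
    It(D, rhoD, 1 (x) b), because the two structure formulas agree on pure
    tensors ([tens_it_iso]).  A cyclic algebra over F is such an iterated
    algebra of the field F, and (L/F_0, sigma, c) (x) F = (K/F, sigma, c), which
    gives the first isomorphism.

    For the second, put T = tau on D and f = t^m - d in D[t; T^-1].  Writing
    powers of t on the left, a t^i = t^i T^i(a), so the candidate map from S_f
    to It(D, T, d) sends \sum_i a_i t^i to the family T^i(a_i)
    ([Sf_it_iso]).  Right division by f is explicit for a polynomial P of degree
    less than 2 m: since x t^s f = x t^(s + m) - x T^-s(d) t^s, the quotient is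
    \sum_s P_(s + m) t^s and the remainder has coefficients
    P_s + P_(s + m) T^-s(d) ([Sf_mulE]).  The wrapped terms, those with
    i + j >= m, carry T^(i + j - m) on the side of S_f and T^(i + j) on the side
    of It(D, T, d); they agree because T^m = 1, as tau has order m = [F : F_0].

    Facts about K = L F (commutation of tau with sigma, tau^m = 1) are checked
    on products x y with x in L and y in F ([composite_ext]). *)

(** * Isomorphisms of algebras *)

Lemma algebra_iso_sym (k : fieldType) (V W : lmodType k)
    (mulV : V -> V -> V) (mulW : W -> W -> W) :
  algebra_iso mulV mulW -> algebra_iso mulW mulV.
Proof.
move=> [phi [psi phiK psiK] phiM].
exists (linear_pack (can2_linear phiK psiK)); first by exists phi.
by move=> x y; apply: (can_inj phiK); rewrite /= phiM !psiK.
Qed.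

Lemma algebra_iso_trans (k : fieldType) (U V W : lmodType k)
    (mulU : U -> U -> U) (mulV : V -> V -> V) (mulW : W -> W -> W) :
  algebra_iso mulU mulV -> algebra_iso mulV mulW -> algebra_iso mulU mulW.
Proof.
move=> [phi phi_bij phiM] [psi psi_bij psiM].
exists (psi \o phi); first exact: bij_comp.
by move=> x y /=; rewrite phiM psiM.
Qed.

(** * Tensor products and families of coefficients *)

Lemma iter_linear (k : fieldType) (V : lmodType k) (f : {linear V -> V}) i :
  linear (iter i f).
Proof. by elim: i => // i IH a x y; rewrite !iterS IH linearP. Qed.

Lemma sum_gmon (V : nmodType) (m : nat) (x : {ffun 'I_m -> V}) :
  \sum_(l < m) gmon m l (x l) = x.
Proof.
apply/ffunP => l'; rewrite sum_ffunE (bigD1 l') //= big1 ?addr0 => [|l nl].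
  by rewrite ffunE eqxx.
by rewrite ffunE ifN // eq_sym.
Qed.

Lemma gmon_linear (k : fieldType) (V : lmodType k) (m l : nat) :
  linear (gmon m l : V -> {ffun 'I_m -> V}).
Proof.
move=> a x y; apply/ffunP => l'; rewrite !ffunE.
by case: eqP => _; rewrite ?scaler0 ?addr0.
Qed.

(** The inverse is built from the maps id (x) (gmon m l), one for each index l,
    applied to the preimages of the coefficients; both composites are the
    identity because [sum_gmon] recovers a family from its monomials. *)
Lemma tens_ffun_bij (k : fieldType) (A B : vectType k) (V : lmodType k)
    (m : nat) (phi : {linear tens A B -> V}) :
    bijective phi ->
  exists2 Phi : {linear tens A {ffun 'I_m -> B} -> {ffun 'I_m -> V}},
    bijective Phi & forall a b, Phi (pure a b) = [ffun l => phi (pure a (b l))].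
Proof.
move=> [psi phiK psiK].
pose psiL := linear_pack (can2_linear phiK psiK).
have [pl pr] := pure_bilinear A B.
have [plF prF] := pure_bilinear A {ffun 'I_m -> B}.
have [Phi PhiE] : exists Phi : {linear tens A {ffun 'I_m -> B} -> {ffun 'I_m -> V}},
    forall a b, Phi (pure a b) = [ffun l => phi (pure a (b l))].
  apply: (tens_universal (phi := fun a (b : {ffun 'I_m -> B}) =>
    [ffun l : 'I_m => phi (pure a (b l))])).
  - by move=> b z a a'; apply/ffunP => l; rewrite !ffunE pl linearP.
  by move=> a z b b'; apply/ffunP => l; rewrite !ffunE pr linearP.
have iota_ex (l : 'I_m) : exists h : {linear tens A B -> tens A {ffun 'I_m -> B}},
    forall a b, h (pure a b) = pure a (gmon m l b).
  apply: (tens_universal (phi := fun a b => pure a (gmon m l b))).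
  - by move=> b z a a'; rewrite plF.
  by move=> a z b b'; rewrite gmon_linear prF.
have [iota iotaE] := choice iota_ex.
have PhiI l Y : Phi (iota l Y) = gmon m l (phi Y).
  pose g := linear_pack (@gmon_linear k V m l).
  apply: (tens_ext (f := Phi \o iota l) (g := g \o phi)) => a b /=.
  rewrite iotaE PhiE; apply/ffunP => l'; rewrite !ffunE.
  case: eqP => _ //.
  have -> : pure a 0 = 0 :> tens A B by apply: (raddf0 (linear_pack (pr a))).
  exact: linear0.
exists Phi => //.
exists (fun g : {ffun 'I_m -> V} => \sum_l iota l (psi (g l))) => [X|g]; last first.
  rewrite linear_sum -[RHS]sum_gmon; apply: eq_bigr => l _.
  by rewrite PhiI psiK.
have PsiP : linear (fun g : {ffun 'I_m -> V} => \sum_l iota l (psiL (g l))).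
  move=> z g g'; rewrite scaler_sumr -big_split; apply: eq_bigr => l _.
  by rewrite !ffunE !linearP.
apply: (tens_ext (f := linear_pack PsiP \o Phi) (g := idfun)) => a b /=.
rewrite PhiE -[in RHS](sum_gmon b).
rewrite [RHS](linear_sum (linear_pack (prF a))) /=.
by apply: eq_bigr => l _; rewrite ffunE phiK iotaE.
Qed.

(** On pure tensors both products have the coefficients
    a a' (x) rho^j(y_i) y'_j, with a further factor b or 1 (x) b on the terms
    that wrap around, so multiplicativity of phi and its compatibility with
    rho are enough. *)
Lemma tens_it_iso (k : fieldType) (A B : vectType k) (D : lmodType k)
    (mulA : A -> A -> A) (mulB : B -> B -> B) (mulD : D -> D -> D)
    (phi : {linear tens A B -> D}) (m : nat)
    (rho : {linear B -> B}) (rhoD : {linear D -> D}) (one : A) (b : B) :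
    unital_algebra mulA -> unital_algebra mulB -> unital_algebra mulD ->
    (forall e, left_id e mulB -> rho e = e) ->
    (forall e, left_id e mulD -> rhoD e = e) ->
    right_id one mulA -> bijective phi ->
    {morph phi : x y / tens_mul mulA mulB x y >-> mulD x y} ->
    (forall a y, rhoD (phi (pure a y)) = phi (pure a (rho y))) ->
  algebra_iso (tens_mul mulA (@it_mul _ mulB m rho b))
              (@it_mul _ mulD m rhoD (phi (pure one b))).
Proof.
move=> algA algB algD rho1 rhoD1 one_r phi_bij phiM rhoE.
have [Phi Phi_bij PhiE] := @tens_ffun_bij k A B D m phi phi_bij.
exists Phi => //.
have algI := unital_algebra_it m b algB rho1.
have [algJl algJr _] := unital_algebra_it m (phi (pure one b)) algD rhoD1.
have [tl tr] := tens_mul_linear mulA (@it_mul _ mulB m rho b).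
have [_ pr] := pure_bilinear A B.
have pM a y a' y' : mulD (phi (pure a y)) (phi (pure a' y'))
    = phi (pure (mulA a a') (mulB y y')) by rewrite -phiM tens_mul_pure.
have iterE j a y : iter j rhoD (phi (pure a y)) = phi (pure a (iter j rho y)).
  by elim: j => //= j ->; rewrite rhoE.
move=> X Y.
pose g1 Y := linear_pack (tl Y); pose h1 y := linear_pack (algJl y).
pose g2 X := linear_pack (tr X); pose h2 x := linear_pack (algJr x).
apply: (tens_ext (f := Phi \o g1 Y) (g := h1 (Phi Y) \o Phi)) => a y /=.
apply: (tens_ext (f := Phi \o g2 _) (g := h2 _ \o Phi)) => a' y' /=.
rewrite tens_mul_pure // !PhiE; apply/ffunP => l; rewrite !ffunE.
pose pa := linear_pack (pr (mulA a a')).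
rewrite [LHS](_ : _ = (phi \o pa) (\sum_(i < m) \sum_(j < m)
    if (i + j == l)%N then mulB (iter j rho (y i)) (y' j)
    else if (i + j == l + m)%N then mulB (mulB (iter j rho (y i)) (y' j)) b
    else 0)) // linear_sum; apply: eq_bigr => i _.
rewrite linear_sum; apply: eq_bigr => j _ /=.
rewrite !ffunE iterE !pM one_r.
by do 2!case: ifP => // _; rewrite -[RHS](linear0 phi) -[in RHS](linear0 pa).
Qed.

(** * S_f as an iterated algebra *)

Section SfIterated.
Variables (k : fieldType) (D : lmodType k) (mulD : D -> D -> D).
Variables (T T' : {linear D -> D}) (m : nat) (one d : D).
Hypotheses (algD : unital_algebra mulD) (divD : division_algebra mulD).
Hypotheses (one_l : left_id one mulD) (one_r : right_id one mulD).
Hypotheses (TM : {morph T : x y / mulD x y}) (TK : cancel T T')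
  (T'K : cancel T' T).
Hypotheses (m_gt0 : (0 < m)%N) (Tm : forall x, iter m T x = x).

Local Notation f := (smon one m - smon d 0).

Let mul0D z : mulD 0 z = 0.
Proof. by have [lin _ _] := algD; exact: (linear0 (linear_pack (lin z))). Qed.
Let mulD0 z : mulD z 0 = 0.
Proof. by have [_ lin _] := algD; exact: (linear0 (linear_pack (lin z))). Qed.

Lemma aut_one : T' one = one.
Proof.
apply: (can_inj TK); rewrite T'K -[RHS]one_r -[X in mulD _ X]T'K -TM.
by rewrite one_l T'K.
Qed.

Lemma iter_aut_one i : iter i T' one = one.
Proof. by elim: i => //= i ->; exact: aut_one. Qed.

Lemma iter_aut0 i : iter i T' 0 = 0.
Proof. exact: (linear0 (linear_pack (iter_linear T' i))). Qed.

Lemma f_coef i : f i = (if i == m then one else 0) - (if i == 0%N then d else 0).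
Proof. by []. Qed.

Lemma one_neq0 : one != 0.
Proof.
have [[a a0] _] := divD; apply: contraNneq a0 => one0.
by rewrite -[a]one_l one0 mul0D.
Qed.

Lemma f_lead : f m != 0.
Proof. by rewrite f_coef eqxx ifN ?subr0 ?one_neq0 // -lt0n. Qed.

Lemma f_deg i : (m < i)%N -> f i = 0.
Proof. by move=> mi; rewrite f_coef !ifN ?subr0 //; lia. Qed.

(** Multiplying by t^m on the right only shifts coefficients, as T' fixes the
    unit, and t^l d = T'^l(d) t^l. *)
Lemma skew_mul_fE q l : skew_mul mulD T' q f l =
  (if (m <= l)%N then q (l - m)%N else 0) - mulD (q l) (iter l T' d).
Proof.
rewrite skew_mulE //.
have e i : iter i T' (f (l - i)%N) =
    (if (l - i == m)%N then one else 0) - (if (l - i == 0)%N then iter i T' d else 0).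
  rewrite f_coef [LHS](linearB (linear_pack (iter_linear T' i))) /=.
  by congr (_ - _); case: ifP => _; rewrite ?iter_aut_one ?iter_aut0.
under eq_bigr => i _ do rewrite e.
have mulDB x y z : mulD x (y - z) = mulD x y - mulD x z.
  by have [_ lin _] := algD; exact: (linearB (linear_pack (lin x))).
under eq_bigr => i _ do rewrite mulDB.
rewrite sumrB; congr (_ - _); last first.
  rewrite (bigD1 ord_max) //= subnn eqxx big1 ?addr0 // => i ni.
  rewrite ifN ?mulD0 // subn_eq0 -ltnNge ltn_neqAle -ltnS ltn_ord andbT.
  by apply: contraNneq ni => il; apply/eqP/val_inj.
case: leqP => [le|lt].
  have lt : (l - m < l.+1)%N by rewrite ltnS leq_subr.
  rewrite (bigD1 (Ordinal lt)) //= subKn // eqxx one_r big1 ?addr0 // => i ni.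
  rewrite ifN ?mulD0 //; apply: contraNneq ni => im; apply/eqP/val_inj => /=.
  by have := ltn_ord i; lia.
by apply: big1 => i _; rewrite ifN ?mulD0 //; lia.
Qed.

Lemma skewpoly_lt0 (g : skewpoly_lt D m) i : (m <= i)%N -> sval_lt g i = 0.
Proof. by have /asboolP := valP g; apply. Qed.

(** Indexing the convolution by pairs below m, as in the product of the iterated
    algebra, lets the two be compared term by term. *)
Lemma skew_mul_ltE (g h : skewpoly_lt D m) s : skew_mul mulD T' g h s =
  \sum_(i < m) \sum_(j < m)
    if (i + j == s)%N then mulD (sval_lt g i) (iter i T' (sval_lt h j)) else 0.
Proof.
rewrite skew_mulE //.
(* Both the range i <= s of the convolution and the range i < m cut the same sum
   over i < m + s.+1. *)
pose F i := mulD (sval_lt g i) (iter i T' (sval_lt h (s - i)%N)).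
transitivity (\sum_(i < m) if (i <= s)%N then F i else 0).
  pose G i := if (i < m)%N && (i <= s)%N then F i else 0.
  transitivity (\sum_(0 <= i < m + s.+1) G i).
    rewrite [RHS](big_cat_nat (n := s.+1)) ?leq_addl //= [X in _ + X]big_nat.
    rewrite [X in _ + X]big1 ?addr0 => [|i /andP [si _]].
      rewrite big_mkord; apply: eq_bigr => i _; rewrite /G leq_ord andbT.
      by case: ltnP => // mi; rewrite skewpoly_lt0 // mul0D.
    by rewrite /G [(i <= s)%N]leqNgt si andbF.
  rewrite [LHS](big_cat_nat (n := m)) ?leq_addr //= [X in _ + X]big_nat.
  rewrite [X in _ + X]big1 ?addr0 => [|i /andP [mi _]].
    by rewrite big_mkord; apply: eq_bigr => i _; rewrite /G ltn_ord.
  by rewrite /G [(i < m)%N]ltnNge mi.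
apply: eq_bigr => i _; case: leqP => [le|lt]; last first.
  by rewrite big1 // => j _; rewrite ifN //; lia.
have [lt|ge] := ltnP (s - i) m.
  rewrite (bigD1 (Ordinal lt)) //= subnKC // eqxx big1 ?addr0 // => j nj.
  rewrite ifN //; apply: contraNneq nj => ij; apply/eqP/val_inj => /=; lia.
rewrite /F [sval_lt h _]skewpoly_lt0 // iter_aut0 mulD0 big1 // => j _.
by rewrite ifN //; have := ltn_ord j; lia.
Qed.

(** The product has degree less than 2 m, so its upper half of coefficients,
    shifted down by m, is the quotient by f = t^m - d; the term - q d of q f then
    feeds the upper half back into the remainder. *)
Lemma Sf_mulE (g h : skewpoly_lt D m) l : (l < m)%N ->
  sval_lt (Sf_mul mulD T' f g h) l = skew_mul mulD T' g h l
    + mulD (skew_mul mulD T' g h (l + m)%N) (iter l T' d).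
Proof.
move=> lm; pose P := skew_mul mulD T' g h.
have P0 s : (m + m <= s)%N -> P s = 0.
  move=> hs; rewrite /P skew_mul_ltE; apply: big1 => i _; apply: big1 => j _.
  by rewrite ifN //; have := ltn_ord i; have := ltn_ord j; lia.
have qP : (fun s => P (s + m)%N) \in @fin_supp k D.
  by apply/asboolP; exists m => s ms; apply: P0; lia.
have rP : (fun s => if (s < m)%N then P s + mulD (P (s + m)%N) (iter s T' d)
    else 0) \in @fin_supp k D.
  by apply/asboolP; exists m => s ms; rewrite ltnNge ms.
have rP' : Skewpoly rP \in deg_lt m.
  by apply/asboolP => s ms /=; rewrite ltnNge ms.
have div_eq : P = skew_mul mulD T' (Skewpoly qP) f + sval_lt (SkewpolyLt rP').
  apply: skewP => s; rewrite scoefD skew_mul_fE /=.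
  case: (ltnP s m) => hs; first by rewrite sub0r addrC addrK.
  by rewrite subnK // (P0 (s + m)%N) ?leq_add2r // mul0D subr0 addr0.
have T'_inj : injective T' := can_inj T'K.
have [r [_ r_uniq]] := skew_div algD P divD T'_inj f_lead f_deg.
have /r_uniq <- := Sf_mulP algD g h divD T'_inj f_lead f_deg.
by rewrite (r_uniq _ (ex_intro _ _ div_eq)) /= lm.
Qed.

(** The map rewrites a t^i as t^i T^i(a), turning left coefficients into right
    ones. *)
Lemma Sf_it_iso : algebra_iso (@Sf_mul _ _ mulD T' m f) (@it_mul _ mulD m T d).
Proof.
pose G (g : skewpoly_lt D m) : {ffun 'I_m -> D} :=
  [ffun l : 'I_m => iter l T (sval_lt g l)].
have GP : linear G.
  by move=> a g h; apply/ffunP => l; rewrite !ffunE -iter_linear.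
have iterM i : {morph iter i T : x y / mulD x y}.
  by elim: i => // i IH x y; rewrite !iterS IH TM.
have iterK i : cancel (iter i T') (iter i T).
  by elim: i => // i IH x; rewrite iterS iterSr IH T'K.
have iterK' i : cancel (iter i T) (iter i T').
  by elim: i => // i IH x; rewrite iterS iterSr IH TK.
exists (linear_pack GP).
  have HP (x : {ffun 'I_m -> D}) : (fun i => if insub i is Some l
      then iter i T' (x l) else 0) \in @fin_supp k D.
    by apply/asboolP; exists m => i mi; rewrite insubF // ltnNge mi.
  have HP' x : Skewpoly (HP x) \in deg_lt m.
    by apply/asboolP => i mi /=; rewrite insubF // ltnNge mi.
  exists (fun x => SkewpolyLt (HP' x)) => [g|x]; last first.
    by apply/ffunP => l; rewrite ffunE /= valK iterK.
  apply/val_inj/skewP => i /=; case: insubP => [l _ <-|].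
    by rewrite ffunE iterK'.
  by rewrite -leqNgt => mi; rewrite skewpoly_lt0.
move=> g h; apply/ffunP => l; rewrite ffunE Sf_mulE // !skew_mul_ltE.
have sumT (c : 'I_m -> 'I_m -> bool) (u : 'I_m -> 'I_m -> D) :
    iter l T (\sum_i \sum_j if c i j then u i j else 0) =
    \sum_i \sum_j if c i j then iter l T (u i j) else 0.
  have lin := iter_linear T l.
  rewrite [LHS](linear_sum (linear_pack lin)); apply: eq_bigr => i _.
  rewrite [LHS](linear_sum (linear_pack lin)); apply: eq_bigr => j _ /=.
  by case: ifP => // _; exact: (linear0 (linear_pack lin)).
rewrite [LHS](linearD (linear_pack (iter_linear T l))) /= iterM iterK !sumT.
have [mul_lin _ _] := algD.
rewrite [X in _ + X](linear_sum (linear_pack (mul_lin d))) -big_split ffunE.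
apply: eq_bigr => i _ /=.
rewrite [X in _ + X](linear_sum (linear_pack (mul_lin d))) -big_split.
apply: eq_bigr => j _ /=.
rewrite !ffunE -iterD.
have key : mulD (iter (j + i) T (sval_lt g i)) (iter j T (sval_lt h j)) =
    iter (i + j) T (mulD (sval_lt g i) (iter i T' (sval_lt h j))).
  by rewrite iterM [in RHS]addnC [X in _ = mulD _ X]iterD iterK.
case: eqP => [e|_].
  rewrite ifN ?mul0D ?addr0 ?key ?e //.
  by have := ltn_ord l; lia.
rewrite add0r; case: eqP => [e|_]; last by rewrite mul0D.
(* Here i + j = l + m: the two powers of T differ by T^m = 1. *)
by rewrite key e iterD Tm.
Qed.

End SfIterated.

(** * Cyclic algebras and the composite field *)

Lemma cyc_mul1 (k : fieldType) (E : fieldExtType k) (r : nat) (rho : 'AEnd(E))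
    (a : E) : (0 < r)%N ->
  left_id (gmon r 0 1) (cyc_mul rho a) /\ right_id (gmon r 0 1) (cyc_mul rho a).
Proof.
move=> r_gt0; have [linl linr _] := unital_algebra_cyc r rho a.
have iter1 i : iter i rho 1 = 1 by elim: i => //= i ->; rewrite rmorph1.
split=> x; rewrite -[in LHS](sum_gmon x) -[RHS](sum_gmon x).
  rewrite [LHS](linear_sum (linear_pack (linr _))); apply: eq_bigr => i _ /=.
  by rewrite cyc_mul_gmon // add0n ltn_ord iter1 mul1r.
rewrite [LHS](linear_sum (linear_pack (linl _))); apply: eq_bigr => i _ /=.
by rewrite cyc_mul_gmon // addn0 ltn_ord mulr1.
Qed.

(** Additivity spreads the equality from products to K, the span of them. *)
Lemma composite_ext (k : fieldType) (L F K : fieldExtType k)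
    (iL : 'AHom(L, K)) (iF : 'AHom(F, K)) (f g : {linear K -> K}) :
    ({:K} = limg iL * limg iF)%VS ->
    (forall x y, f (iL x * iF y) = g (iL x * iF y)) -> f =1 g.
Proof.
move=> K_comp fg x; apply/eqP; rewrite -subr_eq0.
suff : x \in lker (linfun f - linfun g)%VF.
  by rewrite memv_ker add_lfunE opp_lfunE !lfunE.
have : x \in (limg iL * limg iF)%VS by rewrite -K_comp memvf.
apply: subvP; apply/prodvP => _ _ /memv_imgP [u _ ->] /memv_imgP [v _ ->].
by rewrite memv_ker add_lfunE opp_lfunE !lfunE /= fg subrr.
Qed.

Theorem theorem11
  (F0 : fieldType) (L F : splittingFieldType F0) (n m : nat)
  (galL : galois 1 {:L}) (degL : \dim {:L} = n)
  (sigma : gal_of {:L}) (gensigma : ('Gal({:L} / 1) = <[sigma]>)%g)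
  (galF : galois 1 {:F}) (degF : \dim {:F} = m)
  (tau : gal_of {:F}) (gentau : ('Gal({:F} / 1) = <[tau]>)%g)
  (K : fieldExtType F0) (iL : 'AHom(L, K)) (iF : 'AHom(F, K))
  (LF_disj : linearly_disjoint iL iF)
  (K_comp : ({:K} = limg iL * limg iF)%VS)
  (sigmaK tauK : 'AEnd(K))
  (sigmaK_L : forall x, sigmaK (iL x) = iL (sigma x))
  (sigmaK_F : forall y, sigmaK (iF y) = iF y)
  (tauK_L : forall x, tauK (iL x) = iL x)
  (tauK_F : forall y, tauK (iF y) = iF (tau y))
  (c : F0) (c_neq0 : c != 0) (d : F) (d_neq0 : d != 0) :
  let tensLF := tens_mul (@cyc_mul L n sigma c%:A) (@cyc_mul F m tau d) in
  let mulD := @cyc_mul K n sigmaK c%:A in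
  let dD := gmon n 0 (iF d) in
  let tauD := @coefwise K n tauK in
  let tauD_inv := @coefwise K n (inv_ahom tauK) in
  let f := smon (gmon n 0 1) m - smon dD 0 in
  algebra_iso tensLF (@it_mul _ mulD m tauD dD)
  /\ (division_algebra mulD ->
      algebra_iso (@Sf_mul _ _ mulD tauD_inv m f) tensLF).
Proof.
move=> tensLF mulD dD tauD tauD_inv f.
have n_gt0 : (0 < n)%N by rewrite -degL adim_gt0.
have m_gt0 : (0 < m)%N by rewrite -degF adim_gt0.
have algD : unital_algebra mulD := unital_algebra_cyc n sigmaK c%:A.
have tau_sigma x : tauK (sigmaK x) = sigmaK (tauK x).
  apply: (composite_ext (f := tauK \o sigmaK) (g := sigmaK \o tauK) K_comp).
  move=> u v /=.
  by rewrite !rmorphM /= !(sigmaK_L, sigmaK_F, tauK_L, tauK_F).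
have tauK_iter x : iter m tauK x = x.
  apply: (composite_ext (f := linear_pack (iter_linear tauK m)) (g := idfun)
    K_comp) => u v /=.
  have tauK_iterE i : iter i tauK (iL u * iF v) = iL u * iF ((tau ^+ i)%g v).
    elim: i => [|i IH]; first by rewrite expg0 gal_id.
    by rewrite iterS IH rmorphM /= tauK_L tauK_F expgSr galM ?memvf.
  have tau_m : (tau ^+ m = 1)%g.
    have := galois_dim galF; rewrite dimv1 divn1 degF gentau => ->.
    exact: expg_order.
  by rewrite tauK_iterE tau_m gal_id.
have tauD_lin : linear tauD.
  by move=> a x y; apply/ffunP => i; rewrite !ffunE linearP.
have tauD_inv_lin : linear tauD_inv.
  by move=> a x y; apply/ffunP => i; rewrite !ffunE linearP.
have tauDM : {morph tauD : x y / mulD x y}.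
  have tauK_c : tauK c%:A = c%:A by rewrite linearZ /= rmorph1.
  exact: (coefwiseM tau_sigma tauK_c).
have [tauDK tauD_invK] := coefwise_inv n tauK.
have tauD_iter x : iter m tauD x = x.
  have itE i : iter i tauD x = [ffun l => iter i tauK (x l)].
    by elim: i => [|i IH]; apply/ffunP => l; rewrite ?iterS ?IH !ffunE.
  by apply/ffunP => l; rewrite itE ffunE tauK_iter.
have [e1_l e1_r] : left_id (gmon n 0 1) mulD /\ right_id (gmon n 0 1) mulD.
  exact: cyc_mul1.
have [phi [phi_bij phiE phiM]] :=
  @cyc_tens_iso F0 L F K n iL iF sigma sigmaK c LF_disj K_comp sigmaK_L sigmaK_F.
have iso1 : algebra_iso tensLF (@it_mul _ mulD m tauD dD).
  (* The element d of D is 1 (x) d, seen through phi. *)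
  have -> : dD = phi (pure (gmon n 0 1) d).
    rewrite phiE; apply/ffunP => i; rewrite !ffunE.
    by case: eqP => _; rewrite ?rmorph1 ?rmorph0 ?mul1r ?mul0r.
  rewrite /tensLF (cyc_mul_it m tau d).
  apply: (@tens_it_iso _ _ _ _ (cyc_mul sigma c%:A) *%R mulD phi m tau
    (linear_pack tauD_lin)) => //.
  - exact: unital_algebra_cyc.
  - split; first by move=> y z x x'; rewrite mulrDl scalerAl.
      by move=> x z y y'; rewrite mulrDr scalerAr.
    by exists 1; split => x; rewrite ?mul1r ?mulr1.
  - by move=> e e_l; rewrite -[e]mulr1 e_l rmorph1.
  - move=> e e_l; have -> : e = gmon n 0 1 by rewrite -[LHS]e1_r e_l.
    apply/ffunP => i; rewrite !ffunE.
    by case: eqP => _; rewrite ?rmorph1 ?rmorph0.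
  - exact: (cyc_mul1 _ _ n_gt0).2.
  move=> a y; rewrite /= !phiE; apply/ffunP => i.
  by rewrite !ffunE rmorphM /= tauK_L tauK_F.
split=> // divD; apply: algebra_iso_trans (algebra_iso_sym iso1).
exact: (@Sf_it_iso _ _ mulD (linear_pack tauD_lin) (linear_pack tauD_inv_lin)).
Qed.
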